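(* For every integer $r\ge2$, \[ \mathscr{P}_{D_{r+2}}(q) = \mathscr{P}_{B_{r}}^H(q) + q^2 \mathscr{P}_{B_{r}}^{NH}(q) + (2q+2) \left( 2 \mathscr{P}_{B_{r}}^{NH}(q) - q^2 \sum_{i=1}^{r-1} \mathscr{P}_{B_{i}}^{NH}(q) \right). \]
   Context: A partition of a root $\tilde\alpha$ with $k$ parts is a multiset of $k$ positive roots (repetitions allowed) summing to $\tilde\alpha$. Type $B_n$ ($n\ge1$): with simple roots $\alpha_1,\dots,\alpha_n$, the positive roots are the nonhooked roots $\alpha_i+\cdots+\alpha_j$ ($1\le i\le j\le n$) and the hooked roots $\alpha_i+\cdots+\alpha_{j-1}+2\alpha_j+\cdots+2\alpha_n$ ($1\le i<j\le n$); the highest root is $\alpha_1+2\alpha_2+\cdots+2\alpha_n$ (equal to $\alpha_1$ if $n=1$). $\mathscr{P}^H_{B_n}(q)=\sum_k c_kq^k$ where $c_k$ is the number of partitions of the highest root of $B_n$ with $k$ parts at least one of which is a hooked root; $\mathscr{P}^{NH}_{B_n}(q)=\sum_k d_kq^k$ where $d_k$ is the number of partitions of the highest root of $B_n$ with $k$ parts none of which is hooked. Type $D_m$ ($m\ge4$): with simple roots $\alpha_1,\dots,\alpha_m$ ($\alpha_{m-2}$ the branch node adjacent to $\alpha_{m-3},\alpha_{m-1},\alpha_m$), the positive roots are $\alpha_i+\cdots+\alpha_j$ ($1\le i\le j\le m-1$), $\alpha_m$, $\alpha_i+\cdots+\alpha_{m-2}+\alpha_m$ ($1\le i\le m-2$),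 $\alpha_i+\cdots+\alpha_{m-2}+\alpha_{m-1}+\alpha_m$ ($1\le i\le m-2$), and $\alpha_i+\cdots+\alpha_{j-1}+2\alpha_j+\cdots+2\alpha_{m-2}+\alpha_{m-1}+\alpha_m$ ($1\le i<j\le m-2$); the highest root is $\alpha_1+2\alpha_2+\cdots+2\alpha_{m-2}+\alpha_{m-1}+\alpha_m$. $\mathscr{P}_{D_m}(q)=\sum_k a_kq^k$ where $a_k$ is the number of partitions of the highest root of $D_m$ with exactly $k$ parts. *)

(* Defs.v *)
From mathcomp Require Import all_boot all_order all_algebra.

Set Implicit Arguments.
Unset Strict Implicit.
Unset Printing Implicit Defensive.

Import GRing.Theory.

(* Coordinates in the basis of simple roots, numbered from 0: [a t] is the
   coefficient of alpha_(t+1). In types B and D the coefficients of a positive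
   root are at most 2; taking them in 'I_3 makes [rootvec n] a finite type. *)
Definition rootvec (n : nat) := {ffun 'I_n -> 'I_3}.

Section Partitions.
Variable n : nat.

(* A multiset of k roots is given by its multiplicity function, whose values
   are at most k and sum to k. *)
Definition kmultiset (k : nat) := {ffun rootvec n -> 'I_k.+1}.

Definition has_part k (m : kmultiset k) (a : rootvec n) : bool := 0 < m a.

Definition is_partition (Phi : pred (rootvec n)) (b : 'I_n -> nat)
    (k : nat) (m : kmultiset k) : bool :=
  [&& \sum_a m a == k,
      [forall a, has_part m a ==> Phi a] &
      [forall t, \sum_a m a * a t == b t]].

Definition num_partitions (Phi : pred (rootvec n)) (b : 'I_n -> nat)
    (Q : forall k, pred (kmultiset k)) (k : nat) : nat :=
  #|[set m : kmultiset k | is_partition Phi b m && Q k m]|.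

(* Generating polynomial of [num_partitions]. A partition of b into nonzero
   vectors has at most \sum_t b t parts, so no term is lost by the truncation;
   see [coef_partition_poly]. *)
Definition partition_poly (Phi : pred (rootvec n)) (b : 'I_n -> nat)
    (Q : forall k, pred (kmultiset k)) : {poly int} :=
  (\poly_(k < (\sum_t b t).+1) (num_partitions Phi b Q k)%:Z)%R.

Lemma partition_size (Phi : pred (rootvec n)) (b : 'I_n -> nat) k (m : kmultiset k) :
  (forall a, Phi a -> exists t, 0 < a t) ->
  is_partition Phi b m -> k <= \sum_t b t.
Proof.
move=> Phi_nz /and3P[/eqP card_m /forallP Phi_m /forallP sum_m].
rewrite -[leqLHS]card_m.
under [leqRHS]eq_bigr => t _ do rewrite -(eqP (sum_m t)).
rewrite exchange_big /=; apply: leq_sum => a _; rewrite -big_distrr /=.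
have [->|ma_gt0] := posnP (m a); first by [].
have [t at_gt0] := Phi_nz a (implyP (Phi_m a) ma_gt0).
by rewrite leq_pmulr // (bigD1 t) //= addn_gt0 at_gt0.
Qed.

Lemma coef_partition_poly (Phi : pred (rootvec n)) (b : 'I_n -> nat)
    (Q : forall k, pred (kmultiset k)) (k : nat) :
  (forall a, Phi a -> exists t, 0 < a t) ->
  ((partition_poly Phi b Q)`_k = (num_partitions Phi b Q k)%:Z)%R.
Proof.
move=> Phi_nz; rewrite coef_poly ltnS; case: leqP => // lt_bk.
rewrite /num_partitions (_ : [set _ | _] = set0) ?cards0 //.
apply/setP=> m; rewrite !inE; apply/negP => /andP[/(partition_size Phi_nz)].
by rewrite leqNgt lt_bk.
Qed.

End Partitions.

(* alpha_i + ... + alpha_j *)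
Definition nonhookedB n (a : rootvec n) : bool :=
  [exists i : 'I_n, exists j : 'I_n,
    (i <= j) && [forall t : 'I_n, a t == (i <= t <= j) :> nat]].

(* alpha_i + ... + alpha_(j-1) + 2 alpha_j + ... + 2 alpha_n *)
Definition hookedB n (a : rootvec n) : bool :=
  [exists i : 'I_n, exists j : 'I_n,
    (i < j) && [forall t : 'I_n, a t == (i <= t) + (j <= t) :> nat]].

Definition posrootB n (a : rootvec n) : bool := nonhookedB a || hookedB a.

Definition highestB n (t : 'I_n) : nat := 1 + (0 < t).

Definition some_hooked n k (m : kmultiset n k) : bool :=
  [exists a : rootvec n, has_part m a && hookedB a].

Definition PBH (n : nat) : {poly int} :=
  partition_poly (@posrootB n) (@highestB n) (@some_hooked n).

Definition PBNH (n : nat) : {poly int} :=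
  partition_poly (@posrootB n) (@highestB n) (fun k m => ~~ @some_hooked n k m).

(* With the numbering from 0, the branch node alpha_(m-2) has index m - 3, and
   alpha_(m-1), alpha_m have indices m - 2, m - 1. The five families are
     alpha_i + ... + alpha_j, j <= m - 1;
     alpha_m;
     alpha_i + ... + alpha_(m-2) + alpha_m;
     alpha_i + ... + alpha_(m-2) + alpha_(m-1) + alpha_m;
     alpha_i + ... + alpha_(j-1) + 2 alpha_j + ... + 2 alpha_(m-2)
       + alpha_(m-1) + alpha_m. *)
Definition posrootD m (a : rootvec m) : bool :=
  [|| [exists i : 'I_m, exists j : 'I_m,
        (i <= j < m - 1) && [forall t : 'I_m, a t == (i <= t <= j) :> nat]],
      [forall t : 'I_m, a t == (t == m - 1 :> nat) :> nat],
      [exists i : 'I_m, (i < m - 2) &&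
        [forall t : 'I_m, a t == (i <= t < m - 2) + (t == m - 1 :> nat) :> nat]],
      [exists i : 'I_m, (i < m - 2) &&
        [forall t : 'I_m, a t == (i <= t) :> nat]] |
      [exists i : 'I_m, exists j : 'I_m,
        (i < j < m - 2) &&
        [forall t : 'I_m, a t == (i <= t) + (j <= t < m - 2) :> nat]]].

Definition highestD m (t : 'I_m) : nat := 1 + (0 < t < m - 2).

Definition PD (m : nat) : {poly int} :=
  partition_poly (@posrootD m) (@highestD m) (fun k _ => true).

Lemma posrootB_neq0 n (a : rootvec n) : posrootB a -> exists t, 0 < a t.
Proof.
by case/orP=> /existsP[i /existsP[j /andP[lt_ij /forallP def_a]]];
  exists i; rewrite (eqP (def_a i)) leqnn ?lt_ij.
Qed.

Lemma posrootD_neq0 m (a : rootvec m) : 0 < m -> posrootD a -> exists t, 0 < a t.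
Proof.
move=> m_gt0; case/or4P => [||| /orP[]].
- case/existsP=> i /existsP[j /andP[/andP[le_ij _] /forallP def_a]].
  by exists i; rewrite (eqP (def_a i)) leqnn le_ij.
- have lt_m : m - 1 < m by rewrite ltn_subrL.
  by move/forallP/(_ (Ordinal lt_m))/eqP=> def_a; exists (Ordinal lt_m);
    rewrite def_a /= eqxx.
- by case/existsP=> i /andP[lt_i /forallP def_a];
    exists i; rewrite (eqP (def_a i)) leqnn lt_i.
- by case/existsP=> i /andP[lt_i /forallP def_a];
    exists i; rewrite (eqP (def_a i)) leqnn.
by case/existsP=> i /existsP[j /andP[_ /forallP def_a]];
  exists i; rewrite (eqP (def_a i)) leqnn.
Qed.

Lemma coef_PBH n k :
  ((PBH n)`_k = (num_partitions (@posrootB n) (@highestB n) (@some_hooked n) k)%:Z)%R.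
Proof. exact/coef_partition_poly/posrootB_neq0. Qed.

Lemma coef_PBNH n k :
  ((PBNH n)`_k = (num_partitions (@posrootB n) (@highestB n)
                    (fun k m => ~~ @some_hooked n k m) k)%:Z)%R.
Proof. exact/coef_partition_poly/posrootB_neq0. Qed.

Lemma coef_PD m k : 0 < m ->
  ((PD m)`_k = (num_partitions (@posrootD m) (@highestD m) (fun _ _ => true) k)%:Z)%R.
Proof. by move=> m_gt0; apply: coef_partition_poly => a; apply: posrootD_neq0. Qed.

(* Main.v *)
(* Split a partition of the highest root of D_(r+2) according to its parts
   containing the two end nodes alpha_(r+1), alpha_(r+2). Either a single part
   contains both, or one part contains each; what remains is a partition of the
   highest root h of B_r, minus at most two suffixes e_i = alpha_i + ... + alpha_r,
   into intervals of alpha_1, ..., alpha_r. Write N(v) for the generating polynomial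
   of the partitions of v into intervals, M for the sum of N(h - e_i - e_j) over all
   ordered pairs (i, j), and H, NH for the two polynomials of B_r. Then H is q times
   the sum of N(h - e_i - e_j) over i < j, the sum of the N(h - e_i) is q M, and
   P_D = H + q^2 NH + (2 q + 2) q^2 M. On the other hand q^2 M is
   2 NH - q^2 sum_i N(h - 2 e_i), where N(h - 2 e_i) is NH for B_(i-1), and is 0
   for i = 1. *)

Require Import Defs.
From mathcomp Require Import all_boot all_order all_algebra.
From mathcomp Require Import zify ring.

Import Order.TTheory GRing.Theory Num.Theory.
Local Open Scope ring_scope.

Lemma uniq_cat_separated {T U : eqType} (f : T -> U) c s1 s2 :
    {in s1, forall x, f x = c} -> {in s2, forall x, f x != c} ->
  uniq (s1 ++ s2) = uniq s1 && uniq s2.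
Proof.
move=> f_s1 f_s2; rewrite cat_uniq; case: hasP => // -[x /f_s2 + /f_s1 fx].
by rewrite fx eqxx.
Qed.

(** * Multisets with a given sum *)

Section MultisetPolynomial.
Context {G : zmodType}.
Implicit Types (s S A : seq G) (b p : G) (K k : nat) (l : {additive G -> int}).

(* Pins the codomain structures to the canonical ones of [int], where [lia]
   recognizes the operations. *)
Let subE l b p : l (b - p) = l b - l p.
Proof. exact: raddfB. Qed.

(* Generating polynomial, by number of elements, of the multisets over the list
   [s] with sum [b] and all multiplicities less than [K]. *)
Fixpoint partgen K s b : {poly int} :=
  if s is p :: s' then \sum_(c < K) 'X^c * partgen K s' (b - p *+ c)
  else (b == 0)%:R.

Lemma coef_partgen_widen K1 K2 s b k : (k < K1 <= K2)%N ->
  (partgen K2 s b)`_k = (partgen K1 s b)`_k.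
Proof.
case/andP=> ltkK1 leK12; elim: s b k ltkK1 => //= p s IHs b k ltkK1.
rewrite (big_ord_widen _ (fun c => 'X^c * partgen K1 s (b - p *+ c)) leK12).
rewrite [in RHS]big_mkcond !coef_sum; apply: eq_bigr => c _.
case: (ltnP c K1) => [_|leK1c]; rewrite !coefXnM ?coef0; case: ltnP => //; last by lia.
by move=> lek; apply: IHs; lia.
Qed.

(* Throughout, a linear form [l] that is nonnegative on the listed vectors limits how
   many of them a multiset with sum [b] can use. *)
Lemma partgen_lt0 l {K s b} :
  {in s, forall p, 0 <= l p} -> l b < 0 -> partgen K s b = 0.
Proof.
elim: s b => [|p s IHs] b /=.
  by have [->|//] := eqVneq b 0; rewrite raddf0 ltxx.
move=> /forall_cons[lp ls] lb; apply: big1 => c _; rewrite IHs ?mulr0 //.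
by rewrite raddfB raddfMn subr_lt0 (lt_le_trans lb) // mulrn_wge0.
Qed.

Lemma partgen_neq0 l {K s b} :
  {in s, forall p, l p = 0} -> l b != 0 -> partgen K s b = 0.
Proof.
elim: s b => [|p s IHs] b /=.
  by have [->|//] := eqVneq b 0; rewrite raddf0 eqxx.
move=> /forall_cons[lp ls] lb; apply: big1 => c _; rewrite IHs ?mulr0 //.
by rewrite raddfB raddfMn lp mul0rn subr0.
Qed.

Lemma partgen_cons_lt l {K} k {p s b} : (k <= K)%N ->
    {in p :: s, forall x, 0 <= l x} -> l b < l p *+ k ->
  partgen K (p :: s) b = \sum_(c < k) 'X^c * partgen K s (b - p *+ c).
Proof.
move=> lekK /forall_cons[lp ls] lb /=.
rewrite (big_ord_widen _ (fun c => 'X^c * partgen K s (b - p *+ c)) lekK).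
rewrite [RHS]big_mkcond; apply: eq_bigr => c _; case: ltnP => // lekc.
rewrite (partgen_lt0 l) ?mulr0 // raddfB raddfMn subr_lt0.
by apply: lt_le_trans lb _; rewrite ler_wpMn2l.
Qed.

Lemma partgen_widen K1 K2 s b : (K1 <= K2)%N ->
    {in s, forall p, exists l, l b < l p *+ K1 /\ {in s, forall x, 0 <= l x}} ->
  partgen K2 s b = partgen K1 s b.
Proof.
move=> leK12; elim: s b => // p s IHs b bounded.
have /forall_cons[[l [lb l_ge0]] bounded_s] := bounded.
rewrite (partgen_cons_lt l K1) //=; apply: eq_bigr => c _; congr (_ * _).
apply: IHs => q /bounded_s[l' [lb' /forall_cons[lp' ls']]].
exists l'; split=> //; apply: le_lt_trans lb'.
by rewrite raddfB raddfMn gerBl mulrn_wge0.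
Qed.

Lemma partgen_cat_none l {K S A b} : (0 < K)%N ->
    {in S ++ A, forall p, 0 <= l p} -> {in S, forall p, l b < l p} ->
  partgen K (S ++ A) b = partgen K A b.
Proof.
move=> K_gt0; elim: S => // p S IHS.
rewrite cat_cons => l_ge0 /forall_cons[lbp lbS].
have /forall_cons[_ l_ge0'] := l_ge0.
rewrite (partgen_cons_lt l 1) // big_ord_recl big_ord0 addr0.
by rewrite expr0 mul1r mulr0n subr0 IHS.
Qed.

Lemma partgen_cat_once l {K S A b} : (1 < K)%N ->
    {in S ++ A, forall p, 0 <= l p} -> {in S, forall p, l b < l p *+ 2} ->
  partgen K (S ++ A) b =
    partgen K A b + 'X * \sum_(p <- S) partgen K A (b - p).
Proof.
move=> K_gt1; elim: S => [|p S IHS]; first by rewrite big_nil mulr0 addr0.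
rewrite cat_cons => l_ge0 /forall_cons[lbp lbS].
have /forall_cons[_ l_ge0'] := l_ge0.
rewrite (partgen_cons_lt l 2) // !big_ord_recl big_ord0 /= mulr0n subr0 mulr1n.
rewrite (@partgen_cat_none l _ _ _ (b - p)) ?(ltnW K_gt1) // => [|q /lbS]; last first.
  by rewrite subE; lia.
by rewrite IHS // big_cons; ring.
Qed.

Lemma partgen_cat_one l {K S A b} : (1 < K)%N -> 0 < l b ->
    {in S, forall p, l p = l b} -> {in A, forall p, l p = 0} ->
  partgen K (S ++ A) b = 'X * \sum_(p <- S) partgen K A (b - p).
Proof.
move=> K_gt1 lb lS lA; rewrite (partgen_cat_once l) //.
- by rewrite (partgen_neq0 l) ?add0r ?gt_eqF.
- by move=> p; rewrite mem_cat => /orP[/lS->|/lA->//]; exact: ltW.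
by move=> p /lS->; rewrite mulr2n ltrDl.
Qed.

(* Doubling turns the sum over unordered pairs of elements into a sum over
   ordered pairs plus a diagonal correction. *)
Lemma partgen_cat_two l {K S A b} : (2 < K)%N -> 0 < l b ->
    {in S, forall p, l p *+ 2 = l b} -> {in A, forall p, l p = 0} ->
  2 * partgen K (S ++ A) b =
    'X^2 * (\sum_(p <- S) \sum_(q <- S) partgen K A (b - p - q)
            + \sum_(p <- S) partgen K A (b - p - p)).
Proof.
move=> K_gt2 lb + lA; elim: S => [|p S IHS].
  by rewrite !big_nil addr0 mulr0 (partgen_neq0 l) ?mulr0 ?gt_eqF.
move=> /forall_cons[lp lS].
have l_ge0 : {in p :: S ++ A, forall x, 0 <= l x}.
  apply/forall_cons; split; first by lia.
  by move=> x; rewrite mem_cat => /orP[/lS|/lA]; lia.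
rewrite cat_cons (partgen_cons_lt l 3) //; last by lia.
have /forall_cons[_ l_ge0'] := l_ge0.
rewrite !big_ord_recl big_ord0 /= mulr0n subr0 mulr1n.
have -> : b - p *+ 2 = b - p - p by rewrite mulr2n opprD addrA.
rewrite (@partgen_cat_one l _ _ _ (b - p)) //; first last.
- by move=> q /lS; rewrite subE; lia.
- by rewrite subE; lia.
- exact: ltnW.
rewrite (@partgen_cat_none l _ _ _ (b - p - p)) ?(ltn_trans _ K_gt2) //; last first.
  by move=> q /lS; rewrite !subE; lia.
rewrite expr0 mul1r mulrDr IHS // !big_cons.
under [\sum_(i <- S) \sum_(j <- p :: S) _]eq_bigr => q _ do rewrite big_cons addrAC.
by rewrite big_split /=; ring.
Qed.

End MultisetPolynomial.

Section FfunUpdate.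
Context {T : finType} {R : finType}.
Implicit Types (p a : T) (c d : R) (m : {ffun T -> R}).

Definition ffun_update p c m : {ffun T -> R} :=
  [ffun a => if a == p then c else m a].

Lemma ffun_update_id p c d m :
  m p = d -> ffun_update p d (ffun_update p c m) = m.
Proof. by move=> <-; apply/ffunP=> a; rewrite !ffunE; case: eqP => [->|]. Qed.

Lemma sum_ffun_update {V : nmodType} d p (P : pred {ffun T -> R})
    (F : {ffun T -> R} -> V) :
  \sum_(m | P m) F m =
    \sum_c \sum_(m : {ffun T -> R} | (m p == d) && P (ffun_update p c m))
      F (ffun_update p c m).
Proof.
rewrite (partition_big (fun m : {ffun T -> R} => m p) predT) //.
apply: eq_bigr => c _.
rewrite (reindex_onto (ffun_update p c) (ffun_update p d)); last first.
  by move=> m /andP[_ /eqP]; exact: ffun_update_id.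
apply: eq_bigl => m; rewrite [ffun_update p c m p]ffunE eqxx eqxx andbT andbC.
congr (_ && _); apply/eqP/eqP => [<-|]; last exact: ffun_update_id.
by rewrite ffunE eqxx.
Qed.

Lemma big_ffun_update {A : Type} {idx : A} (op : Monoid.com_law idx) p c m
    (F : T -> R -> A) :
  F p (m p) = idx ->
  \big[op/idx]_a F a (ffun_update p c m a) = op (F p c) (\big[op/idx]_a F a (m a)).
Proof.
move=> Fp; rewrite (bigD1 p) //= [in RHS](bigD1 p) //= Fp ffunE eqxx Monoid.mul1m.
by congr (op _ _); apply: eq_bigr => a /negPf ap; rewrite ffunE ap.
Qed.

End FfunUpdate.

Section CountMultisets.
Context {T : finType}.
Implicit Types (s : seq T) (p : T) (K k : nat).

Definition supported_in {K} (m : {ffun T -> 'I_K.+1}) s : bool :=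
  [forall a, (0 < m a)%N ==> (a \in s)].

Lemma supported_in_nil {K} (m : {ffun T -> 'I_K.+1}) :
  supported_in m [::] = (m == [ffun=> ord0]).
Proof.
apply/forallP/eqP => [m0|-> a]; last by rewrite ffunE.
by apply/ffunP=> a; apply/val_inj/eqP; have := m0 a; rewrite ffunE implybF -eqn0Ngt.
Qed.

Lemma supported_in_eq0 {K} {m : {ffun T -> 'I_K.+1}} {s p} :
  supported_in m s -> p \notin s -> m p = ord0.
Proof.
move=> /forallP/(_ p) + /negPf pNs; rewrite pNs implybF -eqn0Ngt => /eqP mp.
exact: val_inj.
Qed.

Lemma supported_in_cons {K} p s c (m : {ffun T -> 'I_K.+1}) : p \notin s ->
  (m p == ord0) && supported_in (ffun_update p c m) (p :: s) = supported_in m s.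
Proof.
move=> pNs; apply/andP/forallP => [[/eqP mp /forallP supp] a|supp].
  have := supp a; rewrite ffunE inE; case: eqP => [->|] //=.
  by rewrite mp.
split; first by apply/eqP; apply: supported_in_eq0 pNs; apply/forallP.
apply/forallP=> a; rewrite ffunE inE; case: eqP => [_|_] /=; last exact: supp.
exact: implybT.
Qed.

Lemma partgen_multisets {G : zmodType} (w : T -> G) K s (b : G) : uniq s ->
  partgen K.+1 (map w s) b =
    \sum_(m : {ffun T -> 'I_K.+1} | supported_in m s && (\sum_a w a *+ m a == b))
      'X^(\sum_a m a).
Proof.
elim: s b => [|p s IHs] b /=.
  move=> _; under eq_bigl => m do rewrite supported_in_nil.
  rewrite big_mkcondr (big_pred1 [ffun=> ord0]) //.
  rewrite !big1 => [|a _|a _]; rewrite ?ffunE //.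
  by rewrite eq_sym; case: eqP.
case/andP=> pNs uniq_s; rewrite (sum_ffun_update ord0 p).
apply: eq_bigr => c _; rewrite IHs // big_distrr /=.
rewrite [RHS](eq_bigl (fun m => supported_in m s
    && (\sum_a w a *+ m a == b - w p *+ c))) => [|m]; last first.
  rewrite andbA supported_in_cons //; apply: andb_id2l => supp.
  rewrite (big_ffun_update _ _ _ _ (fun a (d : 'I_K.+1) => w a *+ d)) /=; last first.
    by rewrite (supported_in_eq0 supp pNs).
  by rewrite eq_sym [RHS]eq_sym subr_eq addrC.
apply: eq_bigr => m /andP[supp _].
rewrite (big_ffun_update _ _ _ _ (fun _ (d : 'I_K.+1) => d : nat)) ?exprD //.
by rewrite (supported_in_eq0 supp pNs).
Qed.

Lemma coef_partgen_multisets {G : zmodType} (w : T -> G) K s (b : G) k : uniq s ->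
  (partgen K.+1 (map w s) b)`_k =
    #|[set m : {ffun T -> 'I_K.+1} | [&& (\sum_a m a == k)%N, supported_in m s
                                       & \sum_a w a *+ m a == b]]|%:Z.
Proof.
move=> uniq_s; rewrite partgen_multisets // coef_sum.
under eq_bigr => m _ do rewrite coefXn eq_sym.
rewrite -natr_sum -big_mkcondr sum1dep_card natz; congr Posz.
by apply: eq_card => m; rewrite !inE andbC.
Qed.

End CountMultisets.

(** * Root vectors as polynomials *)

(* Vectors of all lengths live in {poly int}, with alpha_(t+1) encoded as 'X^t, so
   that B_i, B_r and D_(r+2) share one ambient group. *)
Definition vecpoly n (f : 'I_n -> nat) : {poly int} := rVpoly (\row_t (f t)%:Z).

Definition rootpoly {n} (a : rootvec n) : {poly int} := vecpoly n (fun t => a t).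

Lemma coef_vecpoly_ord {n} f (t : 'I_n) : (vecpoly n f)`_t = (f t)%:Z.
Proof. by rewrite coef_rVpoly_ord mxE. Qed.

Lemma coef_vecpoly n (f : nat -> nat) t :
  (vecpoly n (fun t => f t))`_t = ((t < n) * f t)%N%:Z.
Proof.
by rewrite coef_rVpoly; case: insubP => [u -> <-|/negPf->] //; rewrite mxE mul1n.
Qed.

Lemma eq_vecpoly n f g : (vecpoly n f == vecpoly n g) = [forall t, f t == g t].
Proof.
apply/eqP/forallP => [eq_fg t|eq_fg].
  by rewrite -eqz_nat -!coef_vecpoly_ord eq_fg.
by congr rVpoly; apply/rowP=> t; rewrite !mxE (eqP (eq_fg t)).
Qed.

Lemma rootpoly_inj {n} : injective (@rootpoly n).
Proof.
move=> a a' /eqP; rewrite eq_vecpoly => /forallP eq_aa'.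
by apply/ffunP=> t; apply/val_inj/eqP/eq_aa'.
Qed.

Lemma rootpoly_onto n (x : {poly int}) :
  (forall t, 0 <= x`_t <= ((t < n)%N.*2)%:Z) -> exists a : rootvec n, rootpoly a = x.
Proof.
move=> x_bounds; exists [ffun t : 'I_n => inord (absz x`_t)].
apply/polyP=> t; have := x_bounds t; rewrite coef_rVpoly.
case: insubP => [u -> tE|/negPf->] /= x_t; last by lia.
by rewrite mxE ffunE tE inordK; lia.
Qed.

Lemma sum_rootpoly n (m : rootvec n -> nat) :
  \sum_a rootpoly a *+ m a = vecpoly n (fun t => \sum_a m a * a t)%N.
Proof.
under eq_bigr do rewrite -raddfMn; rewrite -raddf_sum; congr rVpoly.
apply/rowP=> t; rewrite summxE mxE -natz natr_sum; apply: eq_bigr => a _.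
by rewrite mulmxnE mxE natz mulnC PoszM -mulr_natr natz.
Qed.

Section PartitionPolynomials.
Context {n : nat}.
Implicit Types (Phi Psi : pred (rootvec n)) (b : 'I_n -> nat).

Lemma partition_poly_split Phi b (Q : forall k, pred (kmultiset n k)) :
  partition_poly Phi b Q + partition_poly Phi b (fun k m => ~~ Q k m) =
    partition_poly Phi b (fun _ _ => true).
Proof.
apply/polyP=> k; rewrite coefD !coef_poly; case: ltnP => // _.
rewrite -PoszD; congr Posz; rewrite /num_partitions -[RHS](cardsID [set m | Q k m]).
by congr (_ + _)%N; apply: eq_card => m; rewrite !inE andbT // andbC.
Qed.

Lemma partition_poly_avoid Phi Psi b :
  partition_poly Phi b (fun _ m => ~~ [exists a, has_part m a && Psi a]) =
    partition_poly (predD Phi Psi) b (fun _ _ => true).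
Proof.
apply: eq_poly => k _; congr (Posz #|pred_of_set _|); apply/setP=> m.
rewrite !inE andbT /is_partition -!andbA; congr (_ && _).
rewrite andbCA [RHS]andbC; congr (_ && _).
rewrite negb_exists; apply/andP/forallP => [[/forallP mPhi /forallP mPsi] a|mP].
  by have := mPhi a; have := mPsi a; case: has_part => //= -> ->.
by split; apply/forallP=> a; have := mP a; case: has_part => //= /andP[].
Qed.

Lemma partition_poly_partgen Phi b K (L : seq {poly int}) :
    (forall a, Phi a -> exists t, 0 < a t)%N -> (forall t, b t < K)%N ->
    uniq L -> {in L, forall x, exists a : rootvec n, rootpoly a = x} ->
    (forall a, Phi a = (rootpoly a \in L)) ->
  partition_poly Phi b (fun _ _ => true) = partgen K L (vecpoly n b).
Proof.
move=> Phi_nz b_lt + L_roots PhiE.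
have [s _ defL] : exists2 s, all (mem (enum (rootvec n))) s & L = map rootpoly s.
  by apply/subset_mapP=> x /L_roots[a <-]; rewrite map_f // mem_enum.
rewrite {L L_roots}defL in PhiE * => /map_uniq uniq_s.
have {}PhiE a : Phi a = (a \in s) by rewrite PhiE (mem_map rootpoly_inj).
apply/polyP=> k; rewrite coef_partition_poly //.
have bounded : {in map rootpoly s, forall p, exists l : {additive {poly int} -> int},
    l (vecpoly n b) < l p *+ K
    /\ {in map rootpoly s, forall x, 0 <= l x}}.
  move=> _ /mapP[a + ->]; rewrite -PhiE => /Phi_nz[t a_gt0]; exists (coefp t).
  split=> [|_ /mapP[a' _ ->]]; rewrite /= !coef_vecpoly_ord //.
  by have := b_lt t; nia.
rewrite -(partgen_widen K (K + k.+1)) ?leq_addr //.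
rewrite (coef_partgen_widen k.+1) ?ltnSn ?leq_addl // coef_partgen_multisets //.
congr Posz; apply: eq_card => m; rewrite !inE andbT /is_partition.
rewrite sum_rootpoly eq_vecpoly; congr [&& _, _ & _].
by apply: eq_forallb => a; rewrite PhiE.
Qed.

End PartitionPolynomials.

Lemma exists_rootpolyP {n} {a : rootvec n} (C : pred nat)
    (f : nat -> nat -> nat) (F : nat -> {poly int}) :
    (forall i t, (i < n)%N -> C i -> (F i)`_t = ((t < n) * f i t)%N%:Z) ->
  reflect (exists i, [/\ (i < n)%N, C i & rootpoly a = F i])
    [exists i : 'I_n, C i && [forall t : 'I_n, a t == f i t :> nat]].
Proof.
move=> F_coef.
have eq_F i : (i < n)%N -> C i ->
    (rootpoly a == F i) = [forall t : 'I_n, a t == f i t :> nat].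
  move=> lt_in Ci; rewrite -eq_vecpoly; congr (_ == _).
  by apply/polyP=> t; rewrite F_coef // coef_vecpoly.
apply: (iffP existsP) => [[i /andP[Ci aE]]|[i [lt_in Ci /eqP aE]]].
  by exists i; split=> //; apply/eqP; rewrite eq_F.
by exists (Ordinal lt_in); rewrite Ci -eq_F.
Qed.

Lemma exists2_rootpolyP {n} {a : rootvec n} (C : rel nat)
    (f : nat -> nat -> nat -> nat) (F : nat -> nat -> {poly int}) :
    (forall i j t, (i < n)%N -> (j < n)%N -> C i j ->
       (F i j)`_t = ((t < n) * f i j t)%N%:Z) ->
  reflect (exists i j, [/\ (i < n)%N, (j < n)%N, C i j & rootpoly a = F i j])
    [exists i : 'I_n, exists j : 'I_n,
      C i j && [forall t : 'I_n, a t == f i j t :> nat]].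
Proof.
move=> F_coef; have rootP i (lt_in : (i < n)%N) :=
  @exists_rootpolyP n a (C i) (f i) (F i) (fun j t => F_coef i j t lt_in).
apply: (iffP existsP) => [[i /rootP[//|j [lt_jn Cij aE]]]|[i [j [lt_in lt_jn Cij aE]]]].
  by exists i, j.
by exists (Ordinal lt_in); apply/rootP=> //; exists j.
Qed.

(** * Type B *)

(* alpha_(i+1) + ... + alpha_k; the zero vector if [k <= i]. *)
Definition ivl i k : {poly int} := vecpoly k (fun t => (i <= t)%N).

Lemma coef_ivl i k t : (ivl i k)`_t = (i <= t < k)%N%:Z.
Proof. by rewrite (coef_vecpoly _ (fun t => (i <= t)%N)) mulnb andbC. Qed.

Lemma ivl_nn n : ivl n n = 0.
Proof. by apply/polyP=> t; rewrite coef_ivl coef0; lia. Qed.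

Definition suffixes n : seq {poly int} := [seq ivl i n | i <- index_iota 0 n].

Fixpoint intervals n : seq {poly int} :=
  if n is n'.+1 then suffixes n ++ intervals n' else [::].

Lemma intervalsS n : intervals n.+1 = suffixes n.+1 ++ intervals n.
Proof. by []. Qed.

(* [hooks n n n] lists the hooked roots of B_n, and [hooks r.+2 r r.+1] the roots of
   D_(r+2) containing both end nodes: there [j = r] gives a zero second term. *)
Definition hooks k n m : seq {poly int} :=
  [seq ivl i k + ivl j n | j <- index_iota 0 m, i <- index_iota 0 j].

Lemma suffixesP n x :
  reflect (exists2 i, (i < n)%N & x = ivl i n) (x \in suffixes n).
Proof.
apply: (iffP mapP) => [[i + ->]|[i lt_in ->]].
  by rewrite mem_index_iota; exists i.
by exists i; rewrite ?mem_index_iota.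
Qed.

Lemma intervalsP n x :
  reflect (exists i j, (i <= j < n)%N /\ x = ivl i j.+1) (x \in intervals n).
Proof.
elim: n x => [|n IHn] x; first by constructor=> -[i [j []]]; lia.
rewrite intervalsS mem_cat; apply: (iffP orP) => [[]|].
- by case/suffixesP=> i lt_in ->; exists i, n; split; [lia|].
- by case/IHn=> i [j [le_ijn ->]]; exists i, j; split; [lia|].
case=> i [j [le_ijn ->]]; have [->|ne_jn] := eqVneq j n.
  by left; apply/suffixesP; exists i => //; lia.
by right; apply/IHn; exists i, j; split; [lia|].
Qed.

Lemma hooksP k n m x :
  reflect (exists i j, (i < j < m)%N /\ x = ivl i k + ivl j n) (x \in hooks k n m).
Proof.
apply: (iffP allpairsPdep) => [[j [i [+ + ->]]]|[i [j [lt_ijm ->]]]].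
  by rewrite !mem_index_iota => lt_jm lt_ij; exists i, j; split; [lia|].
by exists j, i; rewrite !mem_index_iota; split => //; lia.
Qed.

Lemma suffixes_coef_last n : {in suffixes n.+1, forall x : {poly int}, x`_n = 1}.
Proof. by move=> _ /suffixesP[i lt_in ->]; rewrite coef_ivl; lia. Qed.

Lemma intervals_coef_ge n t : (n <= t)%N ->
  {in intervals n, forall x : {poly int}, x`_t = 0}.
Proof. by move=> le_nt _ /intervalsP[i [j [le_ijn ->]]]; rewrite coef_ivl; lia. Qed.

Lemma intervals_coef_bounds n t :
  {in intervals n, forall x : {poly int}, 0 <= x`_t <= 1}.
Proof. by move=> _ /intervalsP[i [j [le_ijn ->]]]; rewrite coef_ivl; lia. Qed.

Lemma hooks_coef_last n : {in hooks n n n, forall x : {poly int}, x`_n.-1 = 2}.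
Proof. by move=> _ /hooksP[i [j [lt_ijn ->]]]; rewrite coefD !coef_ivl; lia. Qed.

Lemma hooks_notin_intervals n : {in hooks n n n, forall x, x \notin intervals n}.
Proof.
move=> x /hooks_coef_last x_last; apply/negP => /(intervals_coef_bounds _ n.-1).
by rewrite x_last.
Qed.

Lemma ivl_inj n i j : (i <= n)%N -> (j <= n)%N -> ivl i n = ivl j n -> i = j.
Proof.
move=> le_in le_jn /polyP eq_ij.
by have := eq_ij i; have := eq_ij j; rewrite !coef_ivl; lia.
Qed.

Lemma suffixes_uniq n : uniq (suffixes n).
Proof.
rewrite map_inj_in_uniq ?iota_uniq // => i j; rewrite !mem_index_iota => lt_in lt_jn.
by apply: ivl_inj; exact: ltnW.
Qed.

Lemma intervals_uniq n : uniq (intervals n).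
Proof.
elim: n => // n IHn; rewrite intervalsS (uniq_cat_separated (coefp n) 1).
- by rewrite suffixes_uniq.
- exact: suffixes_coef_last.
by move=> x /(intervals_coef_ge _ _ (leqnn n)) /= ->.
Qed.

Lemma hook_inj k n i j i' j' : (i < j <= n)%N -> (i' < j' <= n)%N -> (n <= k)%N ->
  ivl i k + ivl j n = ivl i' k + ivl j' n -> i = i' /\ j = j'.
Proof.
move=> lt_ij lt_ij' le_nk /polyP eq_ij.
have coef_eq t : ((i <= t < k) + (j <= t < n) = (i' <= t < k) + (j' <= t < n))%N.
  by have := eq_ij t; rewrite !coefD !coef_ivl -!PoszD => -[].
have le_i'i : (i' <= i)%N by move: (coef_eq i); lia.
have le_ii' : (i <= i')%N by move: (coef_eq i'); lia.
have le_j'j : (j' <= j)%N by move: (coef_eq j); lia.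
have le_jj' : (j <= j')%N by move: (coef_eq j'); lia.
by split; lia.
Qed.

Lemma hooks_uniq k n m : (m <= n.+1)%N -> (n <= k)%N -> uniq (hooks k n m).
Proof.
move=> le_mn le_nk; apply: allpairs_uniq_dep => [|j _|u v]; rewrite ?iota_uniq //.
case/allpairsPdep=> j [i []]; rewrite !mem_index_iota => lt_jm lt_ij ->.
case/allpairsPdep=> j' [i' []]; rewrite !mem_index_iota => lt_jm' lt_ij' ->.
by move=> /= /hook_inj[|||-> ->] //; lia.
Qed.

Lemma nonhookedB_intervals n (a : rootvec n) :
  nonhookedB a = (rootpoly a \in intervals n).
Proof.
apply/(exists2_rootpolyP leq (fun i j t => (i <= t <= j)%N)
        (fun i j => ivl i j.+1))/intervalsP.
- by move=> i j t lt_in lt_jn le_ij; rewrite coef_ivl; lia.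
- by case=> i [j [lt_in lt_jn le_ij aE]]; exists i, j; split; [lia|].
by case=> i [j [le_ijn aE]]; exists i, j; split=> //; lia.
Qed.

Lemma hookedB_hooks n (a : rootvec n) : hookedB a = (rootpoly a \in hooks n n n).
Proof.
apply/(exists2_rootpolyP ltn (fun i j t => (i <= t) + (j <= t))%N
        (fun i j => ivl i n + ivl j n))/hooksP.
- by move=> i j t lt_in lt_jn lt_ij; rewrite coefD !coef_ivl; lia.
- by case=> i [j [lt_in lt_jn lt_ij aE]]; exists i, j; split=> //; apply/andP.
by case=> i [j [/andP[lt_ij lt_jn] aE]]; exists i, j; split=> //; lia.
Qed.

Lemma rootpoly_onto_intervals n k : (k <= n)%N ->
  {in intervals k, forall x, exists a : rootvec n, rootpoly a = x}.
Proof.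
move=> le_kn x xI; apply: rootpoly_onto => t; have [le_kt|lt_tk] := leqP k t.
  by rewrite (intervals_coef_ge _ _ le_kt).
by have := intervals_coef_bounds _ t _ xI; rewrite (leq_trans lt_tk le_kn); lia.
Qed.

Lemma rootpoly_onto_hooks k n m : (n <= k)%N ->
  {in hooks k n m, forall x, exists a : rootvec k, rootpoly a = x}.
Proof.
move=> le_nk _ /hooksP[i [j [_ ->]]]; apply: rootpoly_onto => t.
by rewrite coefD !coef_ivl; lia.
Qed.

Lemma highestB_lt3 n (t : 'I_n) : (highestB t < 3)%N.
Proof. by rewrite /highestB; case: (0 < t)%N. Qed.

Definition topB n : {poly int} := vecpoly n (@highestB n).

Lemma coef_topB n t : (topB n)`_t = ((t < n) * (1 + (0 < t)))%N%:Z.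
Proof. exact: (coef_vecpoly n (fun t => 1 + (0 < t))%N). Qed.

Lemma PBNH_partgen n : PBNH n = partgen 3 (intervals n) (topB n).
Proof.
rewrite /PBNH partition_poly_avoid; apply: partition_poly_partgen.
- by move=> a /andP[_ /posrootB_neq0].
- exact: highestB_lt3.
- exact: intervals_uniq.
- exact: rootpoly_onto_intervals.
move=> a; rewrite -nonhookedB_intervals /= /posrootB.
have : hookedB a -> ~~ nonhookedB a.
  by rewrite hookedB_hooks nonhookedB_intervals; exact: hooks_notin_intervals.
by case: hookedB; case: nonhookedB => // /(_ isT).
Qed.

Lemma PBH_PBNH_partgen n :
  PBH n + PBNH n = partgen 3 (hooks n n n ++ intervals n) (topB n).
Proof.
rewrite partition_poly_split; apply: partition_poly_partgen.
- exact: posrootB_neq0.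
- exact: highestB_lt3.
- rewrite cat_uniq hooks_uniq // intervals_uniq andbT; apply/hasPn => x.
  exact/contraTN/hooks_notin_intervals.
- move=> x; rewrite mem_cat => /orP[].
    exact: rootpoly_onto_hooks.
  exact: rootpoly_onto_intervals.
by move=> a; rewrite mem_cat -hookedB_hooks -nonhookedB_intervals orbC.
Qed.

Lemma partgen_intervals_narrow K n i (b : {poly int}) : (0 < K)%N -> (i <= n)%N ->
    (forall t, (i <= t)%N -> b`_t = 0) ->
  partgen K (intervals n) b = partgen K (intervals i) b.
Proof.
move=> K_gt0 + b0; elim: n => [|n IHn]; first by rewrite leqn0 => /eqP->.
rewrite leq_eqVlt => /predU1P[->//|le_in]; rewrite -IHn // intervalsS.
apply: (partgen_cat_none (coefp n)) => // x; last first.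
  by move=> /suffixes_coef_last /= ->; rewrite b0.
rewrite mem_cat => /orP[/suffixes_coef_last /= -> //|].
by move=> /(intervals_coef_bounds _ n)/andP[].
Qed.

(* As [ivl n n] is zero, an index equal to [n] stands for no suffix. *)
Definition cutB n i j : {poly int} :=
  partgen 3 (intervals n) (topB n - ivl i n - ivl j n).

Lemma cutBC n i j : cutB n i j = cutB n j i.
Proof. by rewrite /cutB addrAC. Qed.

Lemma cutB_nn n : cutB n n n = PBNH n.
Proof. by rewrite /cutB ivl_nn !subr0 PBNH_partgen. Qed.

Lemma cutB_diag n i : (0 < i <= n)%N -> cutB n i i = PBNH i.
Proof.
move=> lt_0in; rewrite /cutB PBNH_partgen.
have -> : topB n - ivl i n - ivl i n = topB i.
  by apply/polyP=> t; rewrite !coefB !coef_topB coef_ivl; lia.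
by apply: partgen_intervals_narrow => [||t]; rewrite ?coef_topB; lia.
Qed.

Lemma cutB_00 n : (0 < n)%N -> cutB n 0 0 = 0.
Proof.
move=> n_gt0; apply: (partgen_lt0 (coefp 0)) => [x|].
  by move=> /(intervals_coef_bounds _ 0)/andP[].
by rewrite /= !coefB coef_topB coef_ivl n_gt0.
Qed.

Lemma cutB_narrow n i j : (0 < n)%N -> (i <= n)%N -> (j <= n)%N ->
  partgen 3 (intervals n) (topB n.+1 - ivl i n.+1 - ivl j n.+1) = cutB n.+1 i j.
Proof.
move=> n_gt0 le_in le_jn; apply/esym/partgen_intervals_narrow => // t le_nt.
by rewrite !coefB coef_topB !coef_ivl; lia.
Qed.

Lemma PBH_cutB n : PBH n = 'X * \sum_(0 <= j < n) \sum_(0 <= i < j) cutB n i j.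
Proof.
apply: (addIr (PBNH n)); rewrite PBH_PBNH_partgen PBNH_partgen addrC.
rewrite (partgen_cat_once (coefp n.-1)) //.
- rewrite big_allpairs_dep; congr (_ + 'X * _); apply: eq_bigr => j _.
  by apply: eq_bigr => i _; rewrite opprD addrA.
- move=> x; rewrite mem_cat => /orP[/hooks_coef_last /= -> //|].
  by move=> /(intervals_coef_bounds _ n.-1)/andP[].
by move=> x /hooks_coef_last /= ->; rewrite coef_topB; lia.
Qed.

Lemma sum_cutB_suffix n : (1 < n)%N ->
  \sum_(0 <= i < n) cutB n i n = 'X * \sum_(0 <= i < n) \sum_(0 <= j < n) cutB n i j.
Proof.
case: n => // n n_gt0; rewrite big_distrr; apply: eq_big_nat => i lt_in.
have b_last : (topB n.+1 - ivl i n.+1)`_n = 1.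
  by rewrite coefB coef_topB coef_ivl; lia.
rewrite {1}/cutB ivl_nn subr0 intervalsS (partgen_cat_one (coefp n)) //= ?b_last //.
- rewrite big_map; congr (_ * _); apply: eq_big_nat => j lt_jn.
  by apply: cutB_narrow; lia.
- exact: suffixes_coef_last.
exact: intervals_coef_ge.
Qed.

Lemma double_PBNH n : (1 < n)%N ->
  2 * PBNH n = 'X^2 * (\sum_(0 <= i < n) \sum_(0 <= j < n) cutB n i j
                       + \sum_(0 <= i < n) cutB n i i).
Proof.
case: n => // n n_gt0.
have top_last : (topB n.+1)`_n = 2 by rewrite coef_topB; lia.
rewrite PBNH_partgen intervalsS (partgen_cat_two (coefp n)) //= ?top_last //.
- rewrite !big_map; congr (_ * (_ + _)); apply: eq_big_nat => i lt_in.
    by rewrite big_map; apply: eq_big_nat => j lt_jn; apply: cutB_narrow; lia.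
  by apply: cutB_narrow; lia.
- by move=> x /suffixes_coef_last /= ->.
exact: intervals_coef_ge.
Qed.

Lemma sum_cutB_diag n : (0 < n)%N ->
  \sum_(0 <= i < n) cutB n i i = \sum_(1 <= i < n) PBNH i.
Proof.
move=> n_gt0; rewrite big_ltn // cutB_00 // add0r.
by apply: eq_big_nat => i lt_1in; apply: cutB_diag; lia.
Qed.

(** * Type D *)

(* The roots of D_(r+2) containing alpha_(r+2) but not alpha_(r+1); the simple root
   alpha_(r+2) itself is the case [i = r]. *)
Definition prongs r : seq {poly int} :=
  [seq ivl i r + 'X^(r.+1) | i <- index_iota 0 r.+1].

Lemma prongsP r x :
  reflect (exists2 i, (i <= r)%N & x = ivl i r + 'X^(r.+1)) (x \in prongs r).
Proof.
apply: (iffP mapP) => [[i + ->]|[i le_ir ->]].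
  by rewrite mem_index_iota => lt_ir; exists i.
by exists i; rewrite ?mem_index_iota.
Qed.

Lemma coef_prong i r t :
  (ivl i r + 'X^(r.+1))`_t = ((t < r.+2) * ((i <= t < r) + (t == r.+1)))%N%:Z.
Proof. by rewrite coefD coef_ivl coefXn natz; lia. Qed.

Lemma coef_hookD r t i j : (i < j <= r)%N ->
  (ivl i r.+2 + ivl j r)`_t = ((t < r.+2) * ((i <= t) + (j <= t < r)))%N%:Z.
Proof. by move=> lt_ijr; rewrite coefD !coef_ivl; lia. Qed.

Lemma hooksD_coef r t : (r <= t < r.+2)%N ->
  {in hooks r.+2 r r.+1, forall x : {poly int}, x`_t = 1}.
Proof. by move=> ge_tr _ /hooksP[i [j [lt_ijr ->]]]; rewrite coef_hookD; lia. Qed.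

Lemma prongs_coef r t : (r <= t < r.+2)%N ->
  {in prongs r, forall x : {poly int}, x`_t = (t == r.+1)%N%:Z}.
Proof. by move=> ge_tr _ /prongsP[i le_ir ->]; rewrite coef_prong; lia. Qed.

Lemma hooksD_suffixes_coef r :
  {in hooks r.+2 r r.+1 ++ suffixes r.+1, forall x : {poly int}, x`_r = 1}.
Proof.
move=> x; rewrite mem_cat => /orP[|/suffixes_coef_last//].
by apply: hooksD_coef; lia.
Qed.

Lemma prongs_intervals_coef r :
  {in prongs r ++ intervals r, forall x : {poly int}, x`_r = 0}.
Proof.
move=> x; rewrite mem_cat => /orP[xP|]; last exact: intervals_coef_ge.
by rewrite (prongs_coef _ _ _ _ xP); lia.
Qed.

Lemma prongs_uniq r : uniq (prongs r).
Proof.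
rewrite map_inj_in_uniq ?iota_uniq // => i j; rewrite !mem_index_iota => lt_ir lt_jr.
by move/addIr; apply: ivl_inj.
Qed.

(* Grouped by the end nodes they contain: both, alpha_(r+1) only, alpha_(r+2) only,
   neither. *)
Definition rootsD r : seq {poly int} :=
  (hooks r.+2 r r.+1 ++ suffixes r.+1) ++ prongs r ++ intervals r.

Lemma mem_rootsD r x : (x \in rootsD r) =
  [|| x \in intervals r.+1, x \in hooks r.+2 r r.+1 | x \in prongs r].
Proof.
by rewrite intervalsS !mem_cat orbACA orbC.
Qed.

Lemma posrootD_intervals r (a : rootvec r.+2) :
  [exists i : 'I_r.+2, exists j : 'I_r.+2,
    (i <= j < r.+1)%N && [forall t : 'I_r.+2, a t == (i <= t <= j)%N :> nat]]
  = (rootpoly a \in intervals r.+1).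
Proof.
apply/(exists2_rootpolyP (fun i j => i <= j < r.+1)%N (fun i j t => (i <= t <= j)%N)
        (fun i j => ivl i j.+1))/intervalsP.
- by move=> i j t lt_i lt_j le_ij; rewrite coef_ivl; lia.
- by case=> i [j [lt_i lt_j le_ij aE]]; exists i, j.
by case=> i [j [le_ij aE]]; exists i, j; split=> //; lia.
Qed.

Lemma posrootD_prongs r (a : rootvec r.+2) :
  [forall t : 'I_r.+2, a t == (t == r.+1 :> nat) :> nat] ||
  [exists i : 'I_r.+2, (i < r)%N &&
    [forall t : 'I_r.+2, a t == ((i <= t < r) + (t == r.+1 :> nat))%N :> nat]]
  = (rootpoly a \in prongs r).
Proof.
have tipE : [forall t : 'I_r.+2, a t == (t == r.+1 :> nat) :> nat]
    = (rootpoly a == ivl r r + 'X^(r.+1)).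
  rewrite -eq_vecpoly; congr (_ == _); apply/polyP=> t.
  by rewrite coef_prong (coef_vecpoly _ (fun t => t == r.+1 : nat)); lia.
have prongP := @exists_rootpolyP _ a (fun i => i < r)%N
  (fun i t => (i <= t < r) + (t == r.+1))%N (fun i => ivl i r + 'X^(r.+1))
  (fun i t _ _ => coef_prong i r t).
rewrite tipE; apply/orP/prongsP => [[/eqP aE|/prongP[i [_ lt_ir aE]]]|[i]].
- by exists r.
- by exists i; first exact: ltnW.
rewrite leq_eqVlt => /predU1P[->|lt_ir] aE; first by left; apply/eqP.
by right; apply/prongP; exists i; split=> //; lia.
Qed.

Lemma posrootD_hooks r (a : rootvec r.+2) :
  [exists i : 'I_r.+2, (i < r)%N &&
    [forall t : 'I_r.+2, a t == (i <= t)%N :> nat]] ||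
  [exists i : 'I_r.+2, exists j : 'I_r.+2, (i < j < r)%N &&
    [forall t : 'I_r.+2, a t == ((i <= t) + (j <= t < r))%N :> nat]]
  = (rootpoly a \in hooks r.+2 r r.+1).
Proof.
have short_hook_coef i t : (i < r.+2)%N -> (i < r)%N ->
    (ivl i r.+2 + ivl r r)`_t = ((t < r.+2) * (i <= t))%N%:Z.
  by move=> _ lt_ir; rewrite coef_hookD; lia.
have long_hook_coef i j t : (i < r.+2)%N -> (j < r.+2)%N -> (i < j < r)%N ->
    (ivl i r.+2 + ivl j r)`_t = ((t < r.+2) * ((i <= t) + (j <= t < r)))%N%:Z.
  by move=> _ _ lt_ijr; rewrite coef_hookD; lia.
have short_hookP := @exists_rootpolyP _ a (fun i => i < r)%N
  (fun i t => (i <= t)%N : nat)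
  (fun i => ivl i r.+2 + ivl r r) short_hook_coef.
have long_hookP := @exists2_rootpolyP _ a (fun i j => i < j < r)%N
  (fun i j t => (i <= t) + (j <= t < r))%N (fun i j => ivl i r.+2 + ivl j r)
  long_hook_coef.
apply/orP/hooksP => [[]|].
- by case/short_hookP=> i [_ lt_ir aE]; exists i, r; rewrite lt_ir leqnn.
- by case/long_hookP=> i [j [_ _ lt_ijr aE]]; exists i, j; split; [lia|].
case=> i [j [lt_ijr]]; have [->|ne_jr] := eqVneq j r => aE.
  by left; apply/short_hookP; exists i; split=> //; lia.
by right; apply/long_hookP; exists i, j; split=> //; lia.
Qed.

Lemma posrootD_rootsD r (a : rootvec r.+2) : posrootD a = (rootpoly a \in rootsD r).
Proof.
rewrite mem_rootsD -posrootD_intervals -posrootD_hooks -posrootD_prongs.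
rewrite /posrootD subn1 subn2 /=.
by congr (_ || _); rewrite orbA orbC.
Qed.

Lemma rootsD_uniq r : uniq (rootsD r).
Proof.
rewrite (uniq_cat_separated (coefp r) 1); first last.
- by move=> x /prongs_intervals_coef /= ->.
- exact: hooksD_suffixes_coef.
rewrite (uniq_cat_separated (coefp r.+1) 1 (hooks _ _ _)); first last.
- by move=> _ /suffixesP[i lt_ir ->]; rewrite /= coef_ivl; lia.
- by apply: hooksD_coef; lia.
rewrite (uniq_cat_separated (coefp r.+1) 1 (prongs r)); first last.
- by move=> x /(intervals_coef_ge _ _ (leqnSn r)) /= ->.
- by move=> x /prongs_coef /= ->; rewrite ?eqxx //; lia.
by rewrite suffixes_uniq prongs_uniq intervals_uniq hooks_uniq //; lia.
Qed.

Lemma rootpoly_onto_rootsD r :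
  {in rootsD r, forall x, exists a : rootvec r.+2, rootpoly a = x}.
Proof.
move=> x; rewrite mem_rootsD => /or3P[||/prongsP[i le_ir ->]].
- exact: rootpoly_onto_intervals.
- by apply: rootpoly_onto_hooks; lia.
by apply: rootpoly_onto => t; rewrite coef_prong; lia.
Qed.

Definition topD r : {poly int} := vecpoly r.+2 (@highestD r.+2).

Lemma coef_topD r t : (topD r)`_t = ((t < r.+2) * (1 + (0 < t < r)))%N%:Z.
Proof.
rewrite /topD /highestD subn2.
exact: (coef_vecpoly r.+2 (fun t => 1 + (0 < t < r))%N).
Qed.

Lemma PD_partgen r : PD r.+2 = partgen 3 (rootsD r) (topD r).
Proof.
apply: partition_poly_partgen.
- by move=> a; apply: posrootD_neq0.
- by move=> t; rewrite /highestD; case: (0 < t < _)%N.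
- exact: rootsD_uniq.
- exact: rootpoly_onto_rootsD.
exact: posrootD_rootsD.
Qed.

Lemma topD_sub_hook r i j : (i < j <= r)%N ->
  topD r - (ivl i r.+2 + ivl j r) = topB r - ivl i r - ivl j r.
Proof.
move=> lt_ijr; apply/polyP=> t.
by rewrite !coefB coef_hookD // coef_topD coef_topB !coef_ivl; lia.
Qed.

Lemma topD_sub_suffix_prong r i j : (i <= r)%N -> (j <= r)%N ->
  topD r - ivl i r.+1 - (ivl j r + 'X^(r.+1)) = topB r - ivl i r - ivl j r.
Proof.
move=> le_ir le_jr; apply/polyP=> t.
by rewrite !coefB coef_prong coef_topD coef_topB !coef_ivl; lia.
Qed.

Lemma PD_cutB r :
  PD r.+2 = 'X * \sum_(0 <= j < r.+1) \sum_(0 <= i < j) cutB r i j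
            + 'X^2 * \sum_(0 <= i < r.+1) \sum_(0 <= j < r.+1) cutB r i j.
Proof.
have prongs_right : {in prongs r, forall x : {poly int}, x`_r.+1 = 1}.
  by move=> x /prongs_coef ->; rewrite ?eqxx //; lia.
have intervals_right : {in intervals r, forall x : {poly int}, x`_r.+1 = 0}.
  exact: intervals_coef_ge.
have top_left : (topD r)`_r = 1 by rewrite coef_topD; lia.
rewrite PD_partgen /rootsD (partgen_cat_one (coefp r)) //; first last.
- exact: prongs_intervals_coef.
- by move=> x /hooksD_suffixes_coef /= ->; rewrite top_left.
- by rewrite /= top_left.
rewrite big_cat mulrDr big_allpairs_dep big_map; congr ('X * _ + _).
  apply: eq_big_nat => j lt_jr; apply: eq_big_nat => i lt_ij.
  have lt_ijr : (i < j <= r)%N by lia.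
  rewrite topD_sub_hook // (partgen_cat_none (coefp r.+1)) //.
  - by move=> x; rewrite mem_cat => /orP[/prongs_right|/intervals_right] /= ->.
  by move=> x /prongs_right /= ->; rewrite !coefB coef_topB !coef_ivl; lia.
rewrite expr2 -mulrA; congr ('X * _); rewrite big_distrr.
apply: eq_big_nat => i lt_ir.
have b_right : (topD r - ivl i r.+1)`_r.+1 = 1.
  by rewrite coefB coef_topD coef_ivl; lia.
rewrite (partgen_cat_one (coefp r.+1)) //= ?b_right //.
rewrite big_map; congr ('X * _); apply: eq_big_nat => j lt_jr.
by rewrite topD_sub_suffix_prong.
Qed.

Theorem theorem5p2 (r : nat) (hr : (2 <= r)%N) :
  PD (r + 2)%N =
    PBH r + 'X^2 * PBNH r +
    (2 * 'X + 2) * (2 * PBNH r - 'X^2 * \sum_(1 <= i < r) PBNH i).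
Proof.
rewrite addn2 PD_cutB PBH_cutB -sum_cutB_diag ?(ltnW hr) //.
rewrite double_PBNH // !big_nat_recr //=.
under [\sum_(0 <= i < r) \sum_(0 <= j < r.+1) _]eq_bigr => i _ do
  rewrite big_nat_recr //=.
rewrite big_split /= cutB_nn.
under [\sum_(0 <= i < r) cutB r r i]eq_bigr => i _ do rewrite cutBC.
by rewrite sum_cutB_suffix //; ring.
Qed.
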